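(* Let $F$ be an infinite field, $R$ an (associative) $F$-algebra and let $(P,Q,\psi)$ be an $R$-system satisfying condition (FS). Assume that there exists a uniquely maximal faithful $\psi$-compatible two-sided ideal of $R$. Let $A$ be an $F$-algebra. Suppose that $\phi:\mathcal{O}_{(P,Q,\psi)}\to A$ is an $F$-algebra homomorphism such that $\phi(p_r)\neq0$ for every $r\in R\setminus\{0\}$. If there exists a group action $\sigma:F^*\to\operatorname{Aut}_F(A)$ such that $\phi\circ\tau^{CP}_t=\sigma_t\circ\phi$ for every $t\in F^*$, then $\phi$ is injective.
   Context: Rings and algebras are associative, not necessarily unital. For $R$-bimodules $P,Q$, $P\otimes Q$ is the $R$-balanced tensor product. ''Linear'' (for maps into a ring) means additive. An $R$-system is a triple $(P,Q,\psi)$ where $P,Q$ are $R$-bimodules and $\psi:P\otimes Q\to R$ is an $R$-bimodule homomorphism. When $R$ is an $F$-algebra it is understood that $P$ and $Q$ are $F$-vector spaces whose $R$-bimodule operations are $F$-bilinear and that $\psi$ is $F$-linear. A covariant representation of $(P,Q,\psi)$ is a quadruple $(S,T,\sigma,B)$ where $B$ is a ring, $S:P\to B$ and $T:Q\to B$ are linear maps, $\sigma:R\to B$ is a ring homomorphism, and $S(pr)=S(p)\sigma(r)$, $S(rp)=\sigma(r)S(p)$, $T(qr)=T(q)\sigma(r)$, $T(rq)=\sigma(r)T(q)$, $\sigma(\psi(p\otimes q))=S(p)T(q)$ for all $r\in R,p\in P,q\in Q$. It is surjective if $B$ is generated as a ring by $\sigma(R)\cup T(Q)\cup S(P)$, injective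 if $\sigma$ is injective. The Toeplitz representation $(\iota_P,\iota_Q,\iota_R,\mathcal{T}_{(P,Q,\psi)})$ is the (up to isomorphism unique) surjective covariant representation such that for every covariant representation $(S,T,\sigma,B)$ there is a unique ring homomorphism $\eta:\mathcal{T}_{(P,Q,\psi)}\to B$ with $\eta\circ\iota_R=\sigma$, $\eta\circ\iota_Q=T$, $\eta\circ\iota_P=S$; it exists and is injective. For $p\in P,q\in Q$: $\theta_{q,p}:Q\to Q$, $x\mapsto q\psi(p\otimes x)$, and $\theta_{p,q}:P\to P$, $y\mapsto\psi(y\otimes q)p$. $\mathcal{F}_P(Q)$ is the additive span of all $\theta_{q,p}$, $\mathcal{F}_Q(P)$ the additive span of all $\theta_{p,q}$. Condition (FS): for all finite sets $\{q_1,\dots,q_n\}\subseteq Q$, $\{p_1,\dots,p_m\}\subseteq P$ there exist $\Theta\in\mathcal{F}_P(Q)$ and $\Omega\in\mathcal{F}_Q(P)$ with $\Theta(q_i)=q_i$ and $\Omega(p_j)=p_j$ for all $i,j$. $\Delta:R\to\operatorname{End}(Q_R)$ is the ring homomorphism $\Delta(r)(q)=rq$. Under (FS) there is a unique ring homomorphism $\pi:\mathcal{F}_P(Q)\to\mathcal{T}_{(P,Q,\psi)}$ with $\pi(\theta_{q,p})=\iota_Q(q)\iota_P(p)$. A two-sided ideal $J$ of $R$ is $\psi$-compatible if $J\subseteq\Delta^{-1}(\mathcal{F}_P(Q))$; a $\psi$-compatible $J$ is faithful if $J\cap\ker\Delta=\{0\}$; a faithful $\psi$-compatible two-sided ideal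 $J$ is uniquely maximal if $J'\subseteq J$ for every faithful $\psi$-compatible two-sided ideal $J'$ of $R$. For $\psi$-compatible $J$, $\mathcal{T}(J)$ is the two-sided ideal of $\mathcal{T}_{(P,Q,\psi)}$ generated by $\{\iota_R(x)-\pi(\Delta(x)):x\in J\}$, $\mathcal{O}_{(P,Q,\psi)}(J):=\mathcal{T}_{(P,Q,\psi)}/\mathcal{T}(J)$ with quotient map $\rho_J$. If $J$ is the uniquely maximal faithful $\psi$-compatible two-sided ideal of $R$, the Cuntz-Pimsner ring is $\mathcal{O}_{(P,Q,\psi)}:=\mathcal{O}_{(P,Q,\psi)}(J)$, and $p_r:=\rho_J(\iota_R(r))$, $y_p:=\rho_J(\iota_P(p))$, $x_q:=\rho_J(\iota_Q(q))$ for $r\in R,p\in P,q\in Q$. It is an $F$-algebra with $\lambda p_r=p_{\lambda r}$, $\lambda y_p=y_{\lambda p}$, $\lambda x_q=x_{\lambda q}$ for $\lambda\in F$. $F^*$ is the multiplicative group of $F$. For $t\in F^*$, $\tau^{CP}_t$ is the unique automorphism of $\mathcal{O}_{(P,Q,\psi)}$ with $\tau^{CP}_t(p_r)=p_r$, $\tau^{CP}_t(y_p)=t\,y_p$, $\tau^{CP}_t(x_q)=t^{-1}x_q$; $t\mapsto\tau^{CP}_t$ is the gauge action. *)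

(* Defs.v *)
From HB Require Import structures.
From mathcomp Require Import all_boot all_algebra.
From mathcomp Require Import boolp classical_sets functions cardinality.

Set Implicit Arguments.
Unset Strict Implicit.
Unset Printing Implicit Defensive.

Import GRing.Theory.
Local Open Scope ring_scope.
Local Open Scope classical_set_scope.

Declare Scope nu_scope.
Delimit Scope nu_scope with nu.
Open Scope nu_scope.

(* Associative rings and algebras, not necessarily unital (MathComp's ring    *)
(* structures all carry a unit).                                              *)

HB.mixin Record Zmodule_isNuRing R of GRing.Zmodule R := {
  numul : R -> R -> R;
  numulA : associative numul;
  numulDl : left_distributive numul +%R;
  numulDr : right_distributive numul +%R
}.

#[short(type="nuRingType")]
HB.structure Definition NuRing :=
  {R of GRing.Zmodule R & Zmodule_isNuRing R}.

Notation "x ** y" := (numul x y) (at level 40, left associativity) : nu_scope.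

HB.mixin Record NuRing_isNuAlgebra (F : fieldType) A
    of NuRing A & GRing.Lmodule F A := {
  nuscaleAl : forall (k : F) (x y : A), k *: (x ** y) = (k *: x) ** y;
  nuscaleAr : forall (k : F) (x y : A), k *: (x ** y) = x ** (k *: y)
}.

#[short(type="nuAlgType")]
HB.structure Definition NuAlgebra (F : fieldType) :=
  {A of NuRing A & GRing.Lmodule F A & NuRing_isNuAlgebra F A}.

Definition ring_hom (A B : nuRingType) (f : A -> B) : Prop :=
  zmod_morphism f /\ {morph f : x y / x ** y}.

Definition alg_hom (F : fieldType) (A B : nuAlgType F) (f : A -> B) : Prop :=
  linear f /\ {morph f : x y / x ** y}.

Definition alg_aut (F : fieldType) (A : nuAlgType F) (f : A -> A) : Prop :=
  alg_hom f /\ bijective f.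

Definition subgroup (V : zmodType) (G : set V) : Prop :=
  G 0 /\ forall x y, G x -> G y -> G (x - y).

Definition additive_span (V : zmodType) (X : set V) : set V :=
  [set x | forall G : set V, subgroup G -> X `<=` G -> G x].

Definition subring (B : nuRingType) (G : set B) : Prop :=
  subgroup G /\ forall x y, G x -> G y -> G (x ** y).

Definition generates_ring (B : nuRingType) (X : set B) : Prop :=
  forall G : set B, subring G -> X `<=` G -> G = [set: B].

Definition two_sided_ideal (R : nuRingType) (J : set R) : Prop :=
  subgroup J /\ forall r x, J x -> J (r ** x) /\ J (x ** r).

Definition ideal_generated (R : nuRingType) (X : set R) : set R :=
  [set x | forall I : set R, two_sided_ideal I -> X `<=` I -> I x].

(* Bimodules over an F-algebra R: F-vector spaces with F-bilinear operations. *)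
HB.mixin Record Lmodule_isBimodule (F : fieldType) (R : nuAlgType F) M
    of GRing.Lmodule F M := {
  lact : R -> M -> M;
  ract : M -> R -> M;
  lactA : forall r s m, lact (r ** s) m = lact r (lact s m);
  ractA : forall m r s, ract m (r ** s) = ract (ract m r) s;
  lractA : forall r m s, ract (lact r m) s = lact r (ract m s);
  lact_linearl : forall m : M, linear (fun r : R => lact r m);
  lact_linearr : forall r : R, linear (lact r);
  ract_linearl : forall r : R, linear (fun m : M => ract m r);
  ract_linearr : forall m : M, linear (ract m)
}.

#[short(type="bimodType")]
HB.structure Definition Bimodule (F : fieldType) (R : nuAlgType F) :=
  {M of GRing.Lmodule F M & Lmodule_isBimodule F R M}.

Notation "r *l m" := (lact r m) (at level 40, left associativity) : nu_scope.
Notation "m *r r" := (ract m r) (at level 40, left associativity) : nu_scope.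

(* A map out of the R-balanced tensor product P (x) Q is given, through its   *)
(* defining universal property, as an R-balanced biadditive map; psi p q      *)
(* stands for psi(p (x) q), and psi is moreover F-linear.                     *)
Record Rsystem (F : fieldType) (R : nuAlgType F) := {
  sysP : bimodType R;
  sysQ : bimodType R;
  psi : sysP -> sysQ -> R;
  psi_linearl : forall q, linear (fun p => psi p q);
  psi_linearr : forall p, linear (psi p);
  psi_balanced : forall p r q, psi (p *r r) q = psi p (r *l q);
  psi_lact : forall r p q, psi (r *l p) q = r ** psi p q;
  psi_ract : forall p q r, psi p (q *r r) = psi p q ** r
}.

Section Systems.
Variables (F : fieldType) (R : nuAlgType F) (X : Rsystem R).
Local Notation P := (sysP X).
Local Notation Q := (sysQ X).
Local Notation psi := (@psi F R X).

(* Covariant representations are ring-level objects: no F-linearity. *)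
Record covariant_rep := {
  crB :> nuRingType;
  crS : P -> crB;
  crT : Q -> crB;
  crR : R -> crB;
  crS_additive : zmod_morphism crS;
  crT_additive : zmod_morphism crT;
  crR_hom : ring_hom crR;
  crS_ract : forall p r, crS (p *r r) = crS p ** crR r;
  crS_lact : forall r p, crS (r *l p) = crR r ** crS p;
  crT_ract : forall q r, crT (q *r r) = crT q ** crR r;
  crT_lact : forall r q, crT (r *l q) = crR r ** crT q;
  cr_psi : forall p q, crR (psi p q) = crS p ** crT q
}.

Definition surjective_rep (C : covariant_rep) : Prop :=
  generates_ring (range (@crR C) `|` range (@crT C) `|` range (@crS C)).

Definition rep_hom (C D : covariant_rep) (eta : C -> D) : Prop :=
  [/\ ring_hom eta,
      forall r, eta (crR C r) = crR D r,
      forall q, eta (crT C q) = crT D q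
    & forall p, eta (crS C p) = crS D p].

Definition is_toeplitz (T : covariant_rep) : Prop :=
  surjective_rep T /\
  forall C : covariant_rep, exists! eta : T -> C, rep_hom eta.

Definition thetaQ (q : Q) (p : P) : Q -> Q := fun x => q *r psi p x.
Definition thetaP (p : P) (q : Q) : P -> P := fun y => psi y q *l p.

Definition FPQ : set (Q -> Q) :=
  additive_span [set f | exists q p, f = thetaQ q p].
Definition FQP : set (P -> P) :=
  additive_span [set f | exists p q, f = thetaP p q].

Definition condition_FS : Prop :=
  forall (qs : seq Q) (ps : seq P),
    exists Theta Omega, [/\ FPQ Theta, FQP Omega,
      forall q, q \in qs -> Theta q = q
    & forall p, p \in ps -> Omega p = p].

Definition Delta (r : R) : Q -> Q := fun q => r *l q.

Definition psi_compatible (J : set R) : Prop := J `<=` Delta @^-1` FPQ.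

Definition faithful (J : set R) : Prop :=
  J `&` [set r | Delta r = 0] = [set 0].

Definition faithful_compatible_ideal (J : set R) : Prop :=
  [/\ two_sided_ideal J, psi_compatible J & faithful J].

Definition uniquely_maximal (J : set R) : Prop :=
  faithful_compatible_ideal J /\
  forall J', faithful_compatible_ideal J' -> J' `<=` J.

(* pi : F_P(Q) -> T, represented by a map on all of Q -> Q whose values       *)
(* outside F_P(Q) are irrelevant.  The product of F_P(Q) is composition.      *)
Definition is_pi (T : covariant_rep) (pi : (Q -> Q) -> T) : Prop :=
  [/\ forall f g, FPQ f -> FPQ g -> pi (f - g) = pi f - pi g,
      forall f g, FPQ f -> FPQ g -> pi (f \o g) = pi f ** pi g
    & forall q p, pi (thetaQ q p) = crT T q ** crS T p].

Definition toeplitz_ideal (T : covariant_rep) (pi : (Q -> Q) -> T)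
    (J : set R) : set T :=
  ideal_generated [set crR T x - pi (Delta x) | x in J].

(* A model of the quotient ring T / T(J), with its quotient map rho_J and the *)
(* F-algebra structure for which the images of the generators scale through   *)
(* R, P and Q.                                                                *)
Record relative_CP (T : covariant_rep) (pi : (Q -> Q) -> T) (J : set R) := {
  cpO :> nuAlgType F;
  cp_rho : T -> cpO;
  cp_rho_hom : ring_hom cp_rho;
  cp_rho_surj : range cp_rho = [set: cpO];
  cp_rho_ker : [set x | cp_rho x = 0] = toeplitz_ideal pi J;
  cp_scaleR : forall (k : F) r,
    k *: cp_rho (crR T r) = cp_rho (crR T (k *: r));
  cp_scaleP : forall (k : F) p,
    k *: cp_rho (crS T p) = cp_rho (crS T (k *: p));
  cp_scaleQ : forall (k : F) q,
    k *: cp_rho (crT T q) = cp_rho (crT T (k *: q))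
}.

Section Generators.
Variables (T : covariant_rep) (pi : (Q -> Q) -> T) (J : set R).
Variable O : relative_CP pi J.

Definition cp_p (r : R) : O := cp_rho O (crR T r).
Definition cp_y (p : P) : O := cp_rho O (crS T p).
Definition cp_x (q : Q) : O := cp_rho O (crT T q).

(* tau_t is only constrained for t in F^*. *)
Definition gauge_action (tau : F -> O -> O) : Prop :=
  forall t : F, t != 0 ->
    [/\ alg_aut (tau t),
        forall r, tau t (cp_p r) = cp_p r,
        forall p, tau t (cp_y p) = t *: cp_y p
      & forall q, tau t (cp_x q) = t^-1 *: cp_x q].

End Generators.
End Systems.

(* Group homomorphisms F^* -> Aut_F(A); the value at t = 0 is irrelevant. *)
Definition unit_group_action (F : fieldType) (A : nuAlgType F)
    (s : F -> A -> A) : Prop :=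
  [/\ forall t : F, t != 0 -> alg_aut (s t),
      s 1 = id
    & forall t u : F, t != 0 -> u != 0 -> s (t * u) = s t \o s u].

(* Main.v *)
(* Write p, y, x for the images of R, P, Q in O.  By (FS), O is spanned by    *)
(* the words x .. x p_r y .. y, and tau_t multiplies a word with k letters x  *)
(* and l letters y by t ^ (l - k).  Since ker phi is gauge invariant and F is *)
(* infinite, a Vandermonde argument shows that ker phi contains the           *)
(* homogeneous components of its elements.  A homogeneous element a of        *)
(* ker phi vanishes by induction on the number of letters: by induction       *)
(* y_v a = 0 and a x_q = 0 whenever this multiplication shortens a.           *)
(* In positive degree (FS) then gives a = 0.  Otherwise a x_q = 0 for all q   *)
(* forces a = p_r - rho (pi Theta) with Theta = Delta r, and the r of this    *)
(* kind for which phi kills a form a faithful psi-compatible ideal, hence     *)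
(* lie in J, where the defining relation of O says that a = 0.                *)
Require Import Defs.
From mathcomp Require Import all_boot all_algebra.
From mathcomp Require Import boolp classical_sets functions cardinality.
From mathcomp Require Import finmap.

Set Implicit Arguments.
Unset Strict Implicit.

Import GRing.Theory.
Local Open Scope ring_scope.
Local Open Scope classical_set_scope.

(** [phi] has a graded kernel and is injective on homogeneous elements, hence injective.
    Equivariance makes the kernel stable under [tau]. On a finite sum of components, [tau t] acts,
    up to a power of [t], as a polynomial in [t], so [vandermonde_separation] puts each component
    into the kernel ([graded_component_eq0]); every element is such a sum ([graded_full]). The core
    is [phi_bihom_eq0]. (FS) supplies one-sided local units: in positive degree they show that an
    element killed by all [y v] is zero ([bihom_ymul_eq0]), otherwise that one killed by all [x q]
    is some [p r - rpi f] ([bihom_mulx_eq0]). Maximality of [J] enters only for the latter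
    ([covariance_ideal_sub]). *)

Section Additive.
Variables (U V : zmodType).

(** * Additive maps and additive spans *)

Lemma zmod_morphism0 (f : U -> V) : zmod_morphism f -> f 0 = 0.
Proof. by move=> fB; rewrite -(subrr 0) fB subrr. Qed.

Lemma zmod_morphism_sum (f : U -> V) n (c : nat -> U) : zmod_morphism f ->
  f (\sum_(i < n) c i) = \sum_(i < n) f (c i).
Proof.
move=> fB.
have fD x y : f (x + y) = f x + f y.
  by rewrite -{1}(opprK y) fB -(add0r (- y)) fB (zmod_morphism0 fB) sub0r opprK.
exact: (big_morph f fD (zmod_morphism0 fB)).
Qed.

Lemma subgroup_additive_span (S : set V) : subgroup (additive_span S).
Proof.
split=> [|x y Sx Sy] G Gsub SG; first by case: Gsub.
by case: (Gsub) => _; apply; [exact: Sx|exact: Sy].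
Qed.

Lemma sub_additive_span (S : set V) : S `<=` additive_span S.
Proof. by move=> x Sx G _; apply. Qed.

Lemma additive_span_ind (S : set V) (K : V -> Prop) :
    K 0 ->
    (forall x y, additive_span S x -> additive_span S y -> K x -> K y ->
       K (x - y)) ->
    (forall x, S x -> K x) ->
  forall x, additive_span S x -> K x.
Proof.
move=> K0 KB KS x Sx.
suff: (additive_span S `&` K) x by case.
apply: Sx; last by move=> y Sy; split; [exact: sub_additive_span|exact: KS].
have [S0 SB] := subgroup_additive_span S.
split=> // y z [Sy Ky] [Sz Kz]; split; [exact: SB|exact: KB].
Qed.

End Additive.

Lemma linear_zmod_morphism (F : fieldType) (U V : lmodType F) (f : U -> V) :
  linear f -> zmod_morphism f.
Proof. by move=> fL x y; rewrite addrC -scaleN1r fL scaleN1r addrC. Qed.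

Section NuRing.
Variable A : nuRingType.
Implicit Types x y z : A.

Lemma numulBr x : zmod_morphism (numul x).
Proof.
by move=> y z; apply/eqP; rewrite eq_sym subr_eq -numulDr subrK.
Qed.

Lemma numulBl z : zmod_morphism (fun x => x ** z).
Proof.
by move=> x y; apply/eqP; rewrite eq_sym subr_eq -numulDl subrK.
Qed.

Lemma numul0r x : x ** 0 = 0. Proof. exact: zmod_morphism0 (numulBr x). Qed.
Lemma numul0l x : 0 ** x = 0. Proof. exact: zmod_morphism0 (numulBl x). Qed.

End NuRing.

(** An infinite field has [n] distinct nonzero points; the Vandermonde matrix there is invertible,
    and column [j] of its inverse combines the [n] vanishing sums into [c j]. *)
Lemma vandermonde_separation (F : fieldType) (V : lmodType F) (n : nat)
    (c : nat -> V) :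
    infinite_set [set: F] ->
    (forall t : F, t != 0 -> \sum_(j < n) t ^+ j *: c j = 0) ->
  forall j, (j < n)%N -> c j = 0.
Proof.
move=> Finf c0 j jn.
have [B B0 nB] : exists2 B : {fset F}, [set` B] `<=` ~` [set 0] &
    (#|` B| >= n)%N.
  apply: infinite_set_fset.
  rewrite -setTD; apply: infinite_setD => //.
pose a := \row_(i < n) (enum_fset B)`_i.
have sz (i : 'I_n) : (i < size (enum_fset B))%N by apply: leq_trans nB.
have a_neq0 i : a 0 i != 0.
  by rewrite mxE; apply/eqP/B0 => /=; apply: mem_nth.
pose M := Vandermonde n a.
have Munit : M \in unitmx.
  rewrite unitmxE unitfE det_Vandermonde.
  apply/prodf_neq0 => i _; apply/prodf_neq0 => k ik.
  by rewrite subr_eq0 !mxE nth_uniq ?fset_uniq ?gtn_eqF.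
pose N := invmx M.
have MN : M *m N = 1%:M by exact: mulmxV.
have -> : c j = \sum_(k < n) (M *m N) k (Ordinal jn) *: c k.
  rewrite MN (bigD1 (Ordinal jn)) //= mxE eqxx scale1r big1 ?addr0 //.
  by move=> i /negPf ij; rewrite mxE ij scale0r.
under eq_bigr do rewrite mxE scaler_suml.
rewrite exchange_big big1 //= => i _.
transitivity (N i (Ordinal jn) *: \sum_(k < n) (a 0 i) ^+ k *: c k).
  by rewrite scaler_sumr; apply: eq_bigr => k _;
    rewrite scalerA mulrC [M _ _]mxE.
by rewrite c0 // scaler0.
Qed.

(** * Relations among the generators of [O], and the image of [F_P(Q)] *)

Section CuntzPimsner.
Variables (F : fieldType) (R : nuAlgType F) (X : Rsystem R).
Variables (T : covariant_rep X) (pi : (sysQ X -> sysQ X) -> T) (J : set R).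
Variable O : relative_CP pi J.
Hypotheses (X_FS : condition_FS X) (pi_spec : is_pi pi).

Local Notation p := (cp_p O).
Local Notation y := (cp_y O).
Local Notation x := (cp_x O).
Local Notation FPQ := (@FPQ F R X).
Local Notation Delta := (@Delta F R X).
Local Notation FQP := (@FQP F R X).

Let rpi (f : sysQ X -> sysQ X) : O := cp_rho O (pi f).

Lemma cp_p_sub : zmod_morphism p.
Proof.
by move=> r s; rewrite /cp_p (crR_hom T).1 (cp_rho_hom O).1.
Qed.

Lemma cp_y_sub : zmod_morphism y.
Proof. by move=> r s; rewrite /cp_y crS_additive (cp_rho_hom O).1. Qed.

Lemma cp_x_sub : zmod_morphism x.
Proof. by move=> r s; rewrite /cp_x crT_additive (cp_rho_hom O).1. Qed.

Lemma cp_pp r s : p r ** p s = p (r ** s).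
Proof. by rewrite /cp_p (crR_hom T).2 (cp_rho_hom O).2. Qed.

Lemma cp_px r q : p r ** x q = x (r *l q).
Proof. by rewrite /cp_x crT_lact (cp_rho_hom O).2. Qed.

Lemma cp_xp q r : x q ** p r = x (q *r r).
Proof. by rewrite /cp_x crT_ract (cp_rho_hom O).2. Qed.

Lemma cp_py r v : p r ** y v = y (r *l v).
Proof. by rewrite /cp_y crS_lact (cp_rho_hom O).2. Qed.

Lemma cp_yp v r : y v ** p r = y (v *r r).
Proof. by rewrite /cp_y crS_ract (cp_rho_hom O).2. Qed.

Lemma cp_yx (v : sysP X) (q : sysQ X) : y v ** x q = p (psi v q).
Proof. by rewrite /cp_p cr_psi (cp_rho_hom O).2. Qed.

Lemma subgroup_FPQ : subgroup FPQ.
Proof. exact: subgroup_additive_span. Qed.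

Lemma rpi_thetaQ q v : rpi (thetaQ q v) = x q ** y v.
Proof. by case: pi_spec => _ _ piE; rewrite /rpi piE (cp_rho_hom O).2. Qed.

Lemma rpiB f g : FPQ f -> FPQ g -> rpi (f - g) = rpi f - rpi g.
Proof.
by case: pi_spec => piB _ _ Ff Fg; rewrite /rpi piB // (cp_rho_hom O).1.
Qed.

Lemma rpi0 : rpi 0 = 0.
Proof. by have [F0 _] := subgroup_FPQ; rewrite -(subrr 0) rpiB // subrr. Qed.

Lemma rpi_x f q : FPQ f -> rpi f ** x q = x (f q).
Proof.
move: f; apply: additive_span_ind => [|f g Ff Fg fx gx|_ [q' [v ->]]].
- by rewrite rpi0 numul0l (zmod_morphism0 cp_x_sub).
- by rewrite rpiB // numulBl fx gx -cp_x_sub.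
- by rewrite rpi_thetaQ -numulA cp_yx cp_xp.
Qed.

Lemma rpi_annihilator f (a : O) :
  FPQ f -> (forall v, y v ** a = 0) -> rpi f ** a = 0.
Proof.
move=> Ff ya0; move: f Ff.
apply: additive_span_ind => [|f g Ff Fg fa ga|_ [q' [v ->]]].
- by rewrite rpi0 numul0l.
- by rewrite rpiB // numulBl fa ga subrr.
- by rewrite rpi_thetaQ -numulA ya0 numul0r.
Qed.

(** On generators, r theta_{q,v} = theta_{rq,v}. Together with [FPQ_comp_Delta] this makes the set
    in [covariance_ideal_sub] a two-sided ideal. *)
Lemma FPQ_Delta_comp r f : FPQ f ->
  FPQ (Delta r \o f) /\ rpi (Delta r \o f) = p r ** rpi f.
Proof.
have rB := linear_zmod_morphism (lact_linearr (s := sysQ X) r).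
have [F0 FB] := subgroup_FPQ.
move: f; apply: additive_span_ind => [|f g Ff Fg [Ff' fE] [Fg' gE]
  |_ [q [v ->]]].
- have -> : Delta r \o 0 = 0 :> (sysQ X -> sysQ X).
    by apply: funext => q; exact: zmod_morphism0 rB.
  by rewrite rpi0 numul0r.
- have -> : Delta r \o (f - g) = (Delta r \o f) - (Delta r \o g).
    by apply: funext => q; exact: rB.
  by rewrite !rpiB // numulBr fE gE; split=> //; exact: FB.
- have -> : Delta r \o thetaQ q v = thetaQ (r *l q) v.
    by apply: funext => q'; rewrite /thetaQ lractA.
  rewrite !rpi_thetaQ numulA cp_px; split=> //.
  by apply: sub_additive_span; exists (r *l q), v.
Qed.

Lemma FPQ_comp_Delta r f : FPQ f ->
  FPQ (f \o Delta r) /\ rpi (f \o Delta r) = rpi f ** p r.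
Proof.
have [F0 FB] := subgroup_FPQ.
move: f; apply: additive_span_ind => [|f g Ff Fg [Ff' fE] [Fg' gE]
  |_ [q [v ->]]].
- by rewrite (_ : 0 \o Delta r = 0 :> (sysQ X -> sysQ X)) // rpi0 numul0l.
- rewrite (_ : (f - g) \o Delta r = (f \o Delta r) - (g \o Delta r)) //.
  by rewrite !rpiB // numulBl fE gE; split=> //; exact: FB.
- have -> : thetaQ q v \o Delta r = thetaQ q (v *r r).
    by apply: funext => q'; rewrite /thetaQ /= psi_balanced.
  rewrite !rpi_thetaQ -numulA cp_yp; split=> //.
  by apply: sub_additive_span; exists q, (v *r r).
Qed.

(* [pi] is only given on [F_P(Q)]; [e] plays the role of its analogue on      *)
(* [F_Q(P)] at [g].                                                           *)
Lemma FQP_multiplier g : FQP g -> exists e : O,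
  [/\ forall v, y v ** e = y (g v),
      forall a, (forall q, a ** x q = 0) -> a ** e = 0
    & forall r, exists2 f, FPQ f & p r ** e = rpi f].
Proof.
have [F0 FB] := subgroup_FPQ.
move: g; apply: additive_span_ind => [|g h _ _ [e [ge ae re]] [d [hd ad rd]]|].
- exists 0; split=> [v|a _|r]; rewrite ?numul0r //.
    by rewrite (zmod_morphism0 cp_y_sub).
  by exists 0; rewrite ?rpi0.
- exists (e - d); split=> [v|a ax|r].
  + by rewrite numulBr ge hd -cp_y_sub.
  + by rewrite numulBr ae // ad // subrr.
  + have [f Ff fE] := re r; have [f' Ff' f'E] := rd r.
    by exists (f - f'); [exact: FB|rewrite numulBr fE f'E rpiB].
- move=> _ [v [q ->]]; exists (x q ** y v); split=> [w|a ax|r].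
  + by rewrite numulA cp_yx cp_py.
  + by rewrite numulA ax numul0l.
  + exists (thetaQ (r *l q) v); last by rewrite numulA cp_px rpi_thetaQ.
    by apply: sub_additive_span; exists (r *l q), v.
Qed.

(** * Homogeneous elements of [O] *)

(* [bihom k l a]: [a] is homogeneous of degree [k - l] and is a sum of words  *)
(* with at most [k] letters [x] and at most [l] letters [y].                  *)
Inductive bihom : nat -> nat -> O -> Prop :=
| bihom_p r : bihom 0 0 (p r)
| bihom_x k l q a : bihom k l a -> bihom k.+1 l (x q ** a)
| bihom_y k l v a : bihom k l a -> bihom k l.+1 (a ** y v)
| bihom_sub k l a b : bihom k l a -> bihom k l b -> bihom k l (a - b)
| bihom_up k l a : bihom k l a -> bihom k.+1 l.+1 a.

Lemma bihom0 k l : bihom k l 0.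
Proof.
elim: k => [|k IHk]; last by rewrite -(numul0r (x 0)); exact: bihom_x.
elim: l => [|l IHl]; last by rewrite -(numul0l (y 0)); exact: bihom_y.
by rewrite -(zmod_morphism0 cp_p_sub); exact: bihom_p.
Qed.

Lemma bihom_pmul k l r a : bihom k l a -> bihom k l (p r ** a).
Proof.
elim=> {k l a} [s|k l q a aE IH|k l v a aE IH|k l a b aE IHa bE IHb
  |k l a aE IH].
- by rewrite cp_pp; exact: bihom_p.
- by rewrite numulA cp_px; exact: bihom_x.
- by rewrite numulA; exact: bihom_y.
- by rewrite numulBr; exact: bihom_sub.
- exact: bihom_up.
Qed.

Lemma bihom_mulp k l r a : bihom k l a -> bihom k l (a ** p r).
Proof.
elim=> {k l a} [s|k l q a aE IH|k l v a aE IH|k l a b aE IHa bE IHb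
  |k l a aE IH].
- by rewrite cp_pp; exact: bihom_p.
- by rewrite -numulA; exact: bihom_x.
- by rewrite -numulA cp_yp; exact: bihom_y.
- by rewrite numulBl; exact: bihom_sub.
- exact: bihom_up.
Qed.

(* By (FS), [x_q] and [y_v] are sums of [x_q' p_r] and [p_r y_v'].            *)
Lemma bihom_cp_x q : bihom 1 0 (x q).
Proof.
have [f [_ [Ff _ fq _]]] := X_FS [:: q] [::].
rewrite -(fq q) ?mem_head //; move: f Ff {fq}.
apply: additive_span_ind => [|f g _ _ fE gE|_ [q' [v ->]]].
- by rewrite (zmod_morphism0 cp_x_sub); exact: bihom0.
- by rewrite [x _]cp_x_sub; exact: bihom_sub.
- by rewrite -cp_xp; exact/bihom_x/bihom_p.
Qed.

Lemma bihom_cp_y v : bihom 0 1 (y v).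
Proof.
have [_ [g [_ Fg _ gv]]] := X_FS [::] [:: v].
rewrite -(gv v) ?mem_head //; move: g Fg {gv}.
apply: additive_span_ind => [|f g _ _ fE gE|_ [v' [q ->]]].
- by rewrite (zmod_morphism0 cp_y_sub); exact: bihom0.
- by rewrite [y _]cp_y_sub; exact: bihom_sub.
- by rewrite -cp_py; exact/bihom_y/bihom_p.
Qed.

(** A [y] on the left cancels the leading [x] through [psi]; if there is none, it joins the letters
    [y]. *)
Lemma bihom_ymul k l v a : bihom k l a ->
  if k is k'.+1 then bihom k' l (y v ** a) else bihom 0 l.+1 (y v ** a).
Proof.
elim=> {k l a} [r|k l q a aE IH|k l w a aE IH|k l a b aE IHa bE IHb
  |k l a aE IH].
- by rewrite cp_yp; exact: bihom_cp_y.
- by rewrite numulA cp_yx; exact: bihom_pmul.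
- by rewrite numulA; case: k IH {aE} => [|k] IH; exact: bihom_y.
- by rewrite numulBr; case: k IHa IHb {aE bE} => [|k] *; exact: bihom_sub.
- by case: k IH {aE} => [|k] IH //; exact: bihom_up.
Qed.

Lemma bihom_mulx k l q a : bihom k l a ->
  if l is l'.+1 then bihom k l' (a ** x q) else bihom k.+1 0 (a ** x q).
Proof.
elim=> {k l a} [r|k l w a aE IH|k l v a aE IH|k l a b aE IHa bE IHb
  |k l a aE IH].
- by rewrite cp_px; exact: bihom_cp_x.
- by rewrite -numulA; case: l IH {aE} => [|l] IH; exact: bihom_x.
- by rewrite -numulA cp_yx; exact: bihom_mulp.
- by rewrite numulBl; case: l IHa IHb {aE bE} => [|l] *; exact: bihom_sub.
- by case: l IH {aE} => [|l] IH //; exact: bihom_up.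
Qed.

(** In positive degree every word starts with a letter [x]; [qs] collects these letters. *)
Lemma bihom_left_unit k l a : bihom k l a -> (l < k)%N ->
  exists qs : seq (sysQ X), forall e : O,
    (forall q, q \in qs -> e ** x q = x q) -> e ** a = a.
Proof.
elim=> {k l a} [r|k l q a aE IH|k l w a aE IH|k l a b aE IHa bE IHb
  |k l a aE IH] //.
- by move=> _; exists [:: q] => e eq; rewrite numulA eq ?mem_head.
- by move=> /ltnW/IH[qs aqs]; exists qs => e /aqs ea; rewrite numulA ea.
- move=> lk; have [qs aqs] := IHa lk; have [qs' bqs] := IHb lk.
  exists (qs ++ qs') => e eqs.
  by rewrite numulBr aqs ?bqs // => q qqs;
    apply: eqs; rewrite mem_cat qqs ?orbT.
Qed.

(** In degree at most 0 a word ends with a letter [y] or reduces to some [p r]. The latter needs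
    degree 0, so [r = 0] in negative degree; the induction uses this when an [x] is prefixed. *)
Lemma bihom_right_unit k l a : bihom k l a -> (k <= l)%N ->
  exists r (vs : seq (sysP X)), ((k < l)%N -> r = 0) /\ forall e : O,
    (forall v, v \in vs -> y v ** e = y v) -> (a - p r) ** e = a - p r.
Proof.
have p0 : p 0 = 0 := zmod_morphism0 cp_p_sub.
elim=> {k l a} [r|k l q a aE IH|k l v a aE IH|k l a b aE IHa bE IHb
  |k l a aE IH].
- by move=> _; exists r, [::]; split=> // e _; rewrite subrr numul0l.
- move=> kl; have [r [vs [r0 avs]]] := IH (ltnW kl).
  exists 0, vs; split=> // e /avs; rewrite r0 // p0 !subr0 -numulA.
  by move->.
- move=> _; exists 0, [:: v]; split=> // e eP.
  by rewrite p0 subr0 -numulA eP ?mem_head.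
- move=> kl; have [r [vs [r0 avs]]] := IHa kl; have [s [ws [s0 bws]]] := IHb kl.
  exists (r - s), (vs ++ ws); split=> [lt_kl|e eP].
    by rewrite r0 // s0 // subr0.
  rewrite cp_p_sub opprD addrACA -opprD numulBl.
  by rewrite avs ?bws // => v vvs; apply: eP; rewrite mem_cat vvs ?orbT.
- exact: IH.
Qed.

(** For [f] fixing the leading letters, [rpi f] is a left unit for [a]; as a combination of products
    [x q ** y v] it also kills [a]. *)
Lemma bihom_ymul_eq0 k l a : bihom k l a -> (l < k)%N ->
  (forall v, y v ** a = 0) -> a = 0.
Proof.
move=> aE lk ya0; have [qs aqs] := bihom_left_unit aE lk.
have [f [_ [Ff _ fq _]]] := X_FS qs [::].
rewrite -(aqs (rpi f)) ?rpi_annihilator // => q qqs.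
by rewrite rpi_x // fq.
Qed.

(* Write [a = p_r + b] and let [e] be a right unit for [b] coming from (FS).  *)
(* Then [a e = 0], so [b = b e = - p_r e], which lies in the image of [pi].   *)
Lemma bihom_mulx_eq0 k l a : bihom k l a -> (k <= l)%N ->
    (forall q, a ** x q = 0) ->
  exists r f, FPQ f /\ a = p r - rpi f.
Proof.
move=> aE kl ax0; have [r [vs [_ avs]]] := bihom_right_unit aE kl.
have [_ [g [_ Fg _ gv]]] := X_FS [::] vs.
have [e [ye ae pe]] := FQP_multiplier Fg.
have aeE : (a - p r) ** e = a - p r by apply: avs => v vvs; rewrite ye gv.
have [f Ff fE] := pe r; exists r, f; split=> //.
by rewrite -fE; apply/eqP; rewrite addrC -subr_eq -aeE numulBl ae // sub0r.
Qed.

(** * The gauge action and the decomposition into homogeneous components *)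

Lemma bihom_gauge (tau : F -> O -> O) t k l a : gauge_action tau -> t != 0 ->
  bihom k l a -> t ^+ k *: tau t a = t ^+ l *: a.
Proof.
move=> tauP t0; have [[[tauL tauM] _] taup tauy taux] := tauP t t0.
elim=> {k l a} [r|k l q a aE IH|k l v a aE IH|k l a b aE IHa bE IHb
  |k l a aE IH].
- by rewrite taup.
- rewrite tauM taux -nuscaleAl scalerA exprSr mulfK //.
  by rewrite nuscaleAr IH -nuscaleAr.
- rewrite tauM tauy -nuscaleAr scalerA mulrC -scalerA nuscaleAl IH.
  by rewrite -nuscaleAl scalerA exprS.
- by rewrite (linear_zmod_morphism tauL) !scalerBr IHa IHb.
- by rewrite !exprS -!scalerA IH.
Qed.

(** With [K] common to all terms, [b j] has degree [K - j], and [bihom_gauge] turns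
    [t ^+ K *: tau t] into multiplication by [t ^+ j], without negative powers. *)
Definition graded (K : nat) : set O :=
  [set a | exists M (b : nat -> O), [/\ forall j, bihom K j (b j),
     forall j, (M <= j)%N -> b j = 0 & a = \sum_(j < M) b j]].

Lemma graded_widen a M (b : nat -> O) N :
    (forall j, (M <= j)%N -> b j = 0) -> a = \sum_(j < M) b j ->
  (M <= N)%N -> a = \sum_(j < N) b j.
Proof.
move=> b0 -> MN; rewrite (big_ord_widen N b) //.
rewrite [RHS](bigID (fun j : 'I_N => j < M)%N) /=.
by rewrite [X in _ = _ + X]big1 ?addr0 // => j; rewrite -leqNgt => /b0.
Qed.

Lemma graded_leq K K' a : (K <= K')%N -> graded K a -> graded K' a.
Proof.
elim: K' => [|K' IH]; first by rewrite leqn0 => /eqP ->.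
rewrite leq_eqVlt => /predU1P[-> //|/IH{}IH] /IH[M [b [bE b0 ->]]].
(* [bihom_up] raises both bounds, so the components shift by one and index 0 gets 0. *)
exists M.+1, (fun j => if j is j'.+1 then b j' else 0); split.
- by case=> [|j]; [exact: bihom0|exact: bihom_up].
- by case=> [|j] //; exact: b0.
- by rewrite big_ord_recl add0r.
Qed.

Lemma subgroup_graded : subgroup (\bigcup_K graded K).
Proof.
split=> [|a b [K _ aK] [L _ bL]].
  exists 0%N => //; exists 0%N, (fun=> 0).
  by split=> [j||]; rewrite ?big_ord0 //; exact: bihom0.
exists (K + L)%N => //.
have [M [c [cE c0 ac]]] := graded_leq (leq_addr L K) aK.
have [N [d [dE d0 bd]]] := graded_leq (leq_addl K L) bL.
exists (M + N)%N, (fun j => c j - d j); split=> [j|j MNj|].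
- exact: bihom_sub.
- rewrite c0 ?d0 ?subrr //; apply: leq_trans MNj;
  by rewrite ?leq_addr ?leq_addl.
- rewrite (graded_widen c0 ac (leq_addr N M)).
  by rewrite (graded_widen d0 bd (leq_addl M N)) sumrB.
Qed.

Lemma bihom00 k l a : bihom k l a -> k = 0%N -> l = 0%N -> exists r, a = p r.
Proof.
elim=> {k l a} [r|//|//|k l a b _ IHa _ IHb k0 l0|//]; first by exists r.
have [r ->] := IHa k0 l0; have [s ->] := IHb k0 l0.
by exists (r - s); rewrite cp_p_sub.
Qed.

Lemma bihom_graded k l a : bihom k l a -> (\bigcup_K graded K) a.
Proof.
move=> aE; exists k => //.
exists l.+1, (fun j => if j == l then a else 0); split=> [j|j lj|].
- by case: eqP => [->|_] //; exact: bihom0.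
- by rewrite gtn_eqF.
- rewrite (bigD1 ord_max) //= eqxx big1 ?addr0 // => i.
  by rewrite -val_eqE /= => /negPf ->.
Qed.

Lemma graded_mul K L a (g : O -> O) : zmod_morphism g ->
    (forall j b, bihom K j b -> bihom L j (g b)) ->
  graded K a -> (\bigcup_K graded K) (g a).
Proof.
move=> gB gE [M [b [bE b0 ->]]]; exists L => //.
exists M, (g \o b); split=> [j|j Mj|] /=.
- exact: gE.
- by rewrite b0 // zmod_morphism0.
- exact: zmod_morphism_sum M b gB.
Qed.

Lemma graded_full a : surjective_rep T -> (\bigcup_K graded K) a.
Proof.
move=> Tgen; pose W := \bigcup_K graded K.
have [W0 WB] := subgroup_graded.
(* Stability of [W] under left multiplication is built into [G], so products need no separate study
   of words: [G] is a subring, and only generators remain to be checked. *)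
pose G : set T := [set z | W (cp_rho O z) /\
  forall b, W b -> W (cp_rho O z ** b)].
have rhoB := (cp_rho_hom O).1; have rhoM := (cp_rho_hom O).2.
have GT : G = [set: T].
  apply: Tgen.
    split; [split|] => [|z w [Wz zW] [Ww wW]|z w [Wz zW] [Ww wW]].
    - rewrite /G /= (zmod_morphism0 rhoB).
      by split=> // b _; rewrite numul0l.
    - rewrite /G /= rhoB; split; first exact: WB.
      by move=> b Wb; rewrite numulBl; apply: WB; [exact: zW|exact: wW].
    - rewrite /G /= rhoM; split; first exact: zW.
      by move=> b Wb; rewrite -numulA; exact/zW/wW.
  move=> _ [[[r _ <-]|[q _ <-]]|[v _ <-]]; split.
  - exact: bihom_graded (bihom_p r).
  - move=> b [K _ bK]; apply: (@graded_mul K K _ (numul (p r))) bK.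
      exact: numulBr.
    by move=> j c; exact: bihom_pmul.
  - exact: bihom_graded (bihom_cp_x q).
  - move=> b [K _ bK]; apply: (@graded_mul K K.+1 _ (numul (x q))) bK.
      exact: numulBr.
    by move=> j c; exact: bihom_x.
  - exact: bihom_graded (bihom_cp_y v).
  (* Raising [K] first guarantees that [bihom_ymul] lowers the first bound and keeps the index
     [j]. *)
  - move=> b [K _ bK]; have bK1 := graded_leq (leqnSn K) bK.
    apply: (@graded_mul K.+1 K _ (numul (y v))) bK1; first exact: numulBr.
    by move=> j c /(bihom_ymul v).
have : range (cp_rho O) a by rewrite cp_rho_surj.
by case=> z _ <-; have [] : G z by rewrite GT.
Qed.

(** * Injectivity of [phi] on homogeneous elements, and separation of components *)

Section Uniqueness.
Variables (A : nuAlgType F) (phi : O -> A).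
Hypotheses (phi_hom : alg_hom phi) (J_max : uniquely_maximal X J).
Hypothesis phi_neq0 : forall r : R, r <> 0 -> phi (p r) <> 0.

Let phiB : zmod_morphism phi := linear_zmod_morphism phi_hom.1.

Lemma phi_p_eq0 r : phi (p r) = 0 -> r = 0.
Proof. by move=> pr0; apply: contrapT => /phi_neq0. Qed.

(** If [x q = 0], then every [p (psi v q)] vanishes, hence every [psi v q]; by (FS), [q] is a
    combination of terms [q' *r psi v q]. *)
Lemma cp_x_eq0 q : x q = 0 -> q = 0.
Proof.
move=> xq0; have psiq0 v : psi v q = 0.
  by apply: phi_p_eq0; rewrite -cp_yx xq0 numul0r zmod_morphism0.
have [f [_ [Ff _ fq _]]] := X_FS [:: q] [::].
rewrite -(fq q) ?mem_head //; move: f Ff {fq}.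
apply: additive_span_ind => [//|f g _ _ fE gE|_ [q' [v ->]]].
  by transitivity (f q - g q) => //; rewrite fE gE subrr.
rewrite /thetaQ psiq0.
exact: zmod_morphism0 (linear_zmod_morphism (ract_linearr q')).
Qed.

(** The set is a faithful compatible ideal: if [Delta r = 0], the condition reads [phi (p r) = 0],
    which forces [r = 0]. *)
Lemma covariance_ideal_sub :
  [set r | FPQ (Delta r) /\ phi (p r - rpi (Delta r)) = 0] `<=` J.
Proof.
case: J_max => _; apply.
have [F0 FB] := subgroup_FPQ.
have DB : zmod_morphism Delta.
  move=> r s; apply: funext => q.
  exact: linear_zmod_morphism (lact_linearl q) r s.
have D0 := zmod_morphism0 DB.
split.
- split.
    split=> [|r s [Fr r0] [Fs s0]] /=.
      by rewrite D0 rpi0 (zmod_morphism0 cp_p_sub) subr0 zmod_morphism0.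
    rewrite DB rpiB // cp_p_sub; split; first exact: FB.
    by rewrite opprD addrACA -opprD phiB r0 s0 subrr.
  move=> s r [Fr r0].
  have DM u w : Delta (u ** w) = Delta u \o Delta w :> (sysQ X -> sysQ X).
    by apply: funext => q; rewrite /Delta lactA.
  split; rewrite /= DM -cp_pp.
    have [? ->] := FPQ_Delta_comp s Fr; split=> //.
    by rewrite -numulBr phi_hom.2 r0 numul0r.
  have [? ->] := FPQ_comp_Delta s Fr; split=> //.
  by rewrite -numulBl phi_hom.2 r0 numul0l.
- by move=> r [].
- apply/seteqP; split=> [r [[_ r0] Dr0]|_ ->].
    by apply: phi_p_eq0; rewrite /= in Dr0; rewrite Dr0 rpi0 subr0 in r0.
  split=> //=.
  by rewrite D0 rpi0 (zmod_morphism0 cp_p_sub) subr0 zmod_morphism0.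
Qed.

Lemma ideal_relation r : J r -> p r = rpi (Delta r).
Proof.
move=> Jr; apply/eqP; rewrite -subr_eq0 -(cp_rho_hom O).1; apply/eqP.
have : toeplitz_ideal pi J (crR T r - pi (Delta r)).
  by move=> I _; apply; exists r.
by rewrite -(cp_rho_ker O).
Qed.

Lemma phi_bihom_eq0 k l a : bihom k l a -> phi a = 0 -> a = 0.
Proof.
have phi0 := zmod_morphism0 phiB; have phiM := phi_hom.2.
have [n] := ubnP (k + l); elim: n => // n IH in k l a *.
move=> kln aE a0.
have ya0 k' v : k = k'.+1 -> y v ** a = 0.
  move=> kE; apply: (IH k' l); first by rewrite kE addSn in kln.
    by have := bihom_ymul v aE; rewrite kE.
  by rewrite phiM a0 numul0r.
have ax0 l' q : l = l'.+1 -> a ** x q = 0.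
  move=> lE; apply: (IH k l'); first by rewrite lE addnS in kln.
    by have := bihom_mulx q aE; rewrite lE.
  by rewrite phiM a0 numul0l.
have [lk|kl] := ltnP l k.
  apply: (bihom_ymul_eq0 aE lk) => v.
  by apply: (ya0 k.-1); rewrite prednK //; apply: leq_trans lk.
have [l0|l_gt0] := posnP l.
  move: kl; rewrite l0 leqn0 => /eqP k0.
  have [r ar] := bihom00 aE k0 l0.
  by move: a0; rewrite ar => /phi_p_eq0 ->; rewrite (zmod_morphism0 cp_p_sub).
have {}ax0 q : a ** x q = 0 by apply: (ax0 l.-1); rewrite prednK.
have [r [f [Ff aE']]] := bihom_mulx_eq0 aE kl ax0.
(* [x] is injective and sends [Delta r q - f q] to [a ** x q = 0]. *)
have Dr : Delta r = f.
  apply: funext => q; apply/eqP; rewrite -subr_eq0; apply/eqP/cp_x_eq0.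
  by rewrite cp_x_sub -cp_px -(rpi_x q Ff) -numulBl -aE' ax0.
have /ideal_relation prE : J r.
  by apply: covariance_ideal_sub; rewrite /= Dr -aE'.
by rewrite aE' prE Dr subrr.
Qed.

Lemma graded_component_eq0 (tau : F -> O -> O) K M (b : nat -> O) :
    infinite_set [set: F] -> gauge_action tau ->
    (forall (t : F) a, t != 0 -> phi a = 0 -> phi (tau t a) = 0) ->
    (forall j, bihom K j (b j)) -> phi (\sum_(j < M) b j) = 0 ->
  forall j, (j < M)%N -> b j = 0.
Proof.
move=> Finf tauP phi_tau bE bsum0 j jM.
apply: (phi_bihom_eq0 (bE j)); move: j jM.
apply: vandermonde_separation Finf _ => t t0.
have phiZ s c : phi (s *: c) = s *: phi c.
  have := phi_hom.1 s c 0; rewrite addr0 => ->.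
  by rewrite (zmod_morphism0 phiB) addr0.
have [[[tauL _] _] _ _ _] := tauP t t0.
have tauB := linear_zmod_morphism tauL.
(* This sum is [t ^+ K *: phi (tau t a)] for [a] the sum of the [b j], hence zero. *)
transitivity (\sum_(j < M) phi (t ^+ K *: tau t (b j))).
  by apply: eq_bigr => j _; rewrite (bihom_gauge tauP t0 (bE j)) phiZ.
under eq_bigr do rewrite phiZ.
rewrite -scaler_sumr -(zmod_morphism_sum M (tau t \o b)) //.
by rewrite -(zmod_morphism_sum M b) // phi_tau // scaler0.
Qed.

End Uniqueness.
End CuntzPimsner.

Theorem corollary6p3
    (F : fieldType) (F_infinite : infinite_set [set: F])
    (R : nuAlgType F) (X : Rsystem R) (X_FS : condition_FS X)
    (T : covariant_rep X) (T_toeplitz : is_toeplitz T)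
    (pi : (sysQ X -> sysQ X) -> T) (pi_spec : is_pi pi)
    (J : set R) (J_max : uniquely_maximal X J)
    (O : relative_CP pi J)
    (tau : F -> O -> O) (tau_gauge : gauge_action tau)
    (A : nuAlgType F) (phi : O -> A) (phi_hom : alg_hom phi)
    (phi_neq0 : forall r : R, r <> 0 -> phi (cp_p O r) <> 0) :
  (exists sigma : F -> A -> A,
     unit_group_action sigma /\
     forall t : F, t != 0 -> phi \o tau t = sigma t \o phi) ->
  injective phi.
Proof.
move=> [sigma [[sigma_aut _ _] equivariant]].
have phiB := linear_zmod_morphism phi_hom.1.
have phi_tau (t : F) a : t != 0 -> phi a = 0 -> phi (tau t a) = 0.
  move=> t0 a0; rewrite -[LHS]/((phi \o tau t) a) equivariant //= a0.
  exact: zmod_morphism0 (linear_zmod_morphism (sigma_aut t t0).1.1).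
suff ker0 a : phi a = 0 -> a = 0.
  move=> a b ab; apply/eqP; rewrite -subr_eq0; apply/eqP/ker0.
  by rewrite phiB ab subrr.
have [K _ [M [b [bE _ ->]]]] := graded_full X_FS a T_toeplitz.1.
move=> bsum0; rewrite big1 // => j _.
exact: (graded_component_eq0 X_FS pi_spec phi_hom J_max phi_neq0
          F_infinite tau_gauge phi_tau bE bsum0).
Qed.
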